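(* Suppose the model is a Markov model with common known initial distribution $q^{(0)}$, and under $\theta_0$ the chain is aperiodic, positive Harris and $V$-geometrically ergodic for some $V:S\to[1,\infty)$: there are an invariant density $q_{\theta_0}$ with $\int V\,dq_{\theta_0}<\infty$ and constants $R<\infty$, $\tau\in(0,1)$ such that $\sup_{|g|\le V}\big|\mathrm{E}_{\theta_0}[g(X_n)|X_0=x]-\int g\,q_{\theta_0}\big|\le RV(x)\tau^n$ for all $x$ and $n$. Assume there are nonnegative functions $M^{(1)}_k$ and functions $f^{(1)}_k$, $k=1,\dots,m$, with $|\log p_{\theta_1}(y|x)-\log p_{\theta_2}(y|x)|\le\sum_{k=1}^m M^{(1)}_k(y,x)|f^{(1)}_k(\theta_2,\theta_1)|$ for all $\theta_1,\theta_2,x,y$, and, for some $\delta>0$, $\int M^{(1)}_k(y,x)^{2+\delta}p_{\theta_0}(y|x)\,dy<V(x)$ for all $k,x$; that there are $C>0$ and $\rho_n\in\mathcal{F}$ with $\int|f^{(1)}_k(\theta,\theta_0)|^{2+\delta}\rho_n(d\theta)\le C/n$ and $\int|f^{(1)}_k(\theta,\theta_0)|\rho_n(d\theta)\le C/\sqrt n$ for all $k,n$; that $\mathcal{K}(\rho_n,\pi)\le C\sqrt n$; and that $\mathrm{E}_{q^{(0)}}[V(X_0)]<\infty$. Then there exist $\epsilon_n=O\big(\max(n^{-1/2},n^{\delta/2}/n)\big)$ such that conditions (C1)–(C3) hold for $\rho_n$ and $\epsilon_n$.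
   Context: Markov model with known initial distribution: for each $\theta\in\Theta\subseteq\mathbb{R}^d$, $p_\theta(y|x)$ is a transition density on the state space $S\subseteq\mathbb{R}^m$ (w.r.t. Lebesgue or counting measure), and $P^{(n)}_\theta$ is the law of $(X_0,\dots,X_n)$ with density $q^{(0)}(x_0)\prod_{i=1}^n p_\theta(x_i|x_{i-1})$, the same $q^{(0)}$ for all $\theta$. $\mathrm{E},\mathrm{Var}$ are under $P^{(n)}_{\theta_0}$. $r_n(\theta,\theta_0):=\log(p^{(n)}_{\theta_0}(X^n)/p^{(n)}_\theta(X^n))$; $\mathcal{K}$ is KL divergence; $\pi$ is a prior and $\mathcal{F}$ a family of distributions on $\Theta$. Conditions: (C1) $\int\mathcal{K}(P^{(n)}_{\theta_0},P^{(n)}_\theta)\rho_n(d\theta)\le n\epsilon_n$; (C2) $\int\mathrm{Var}(r_n(\theta,\theta_0))\rho_n(d\theta)\le n\epsilon_n$; (C3) $\mathcal{K}(\rho_n,\pi)\le n\epsilon_n$. $\epsilon_n=O(a_n)$ means $\epsilon_n\le Ka_n$ for some constant $K$ and all $n$. *)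

(* Defs.v *)
From HB Require Import structures.
From mathcomp Require Import all_boot all_order all_algebra.
From mathcomp Require Import all_classical all_reals all_analysis.
Import Order.TTheory GRing.Theory Num.Theory.
Import numFieldNormedType.Exports.

Set Implicit Arguments.
Unset Strict Implicit.
Unset Printing Implicit Defensive.

Local Open Scope classical_set_scope.
Local Open Scope ring_scope.
Local Open Scope ereal_scope.

(* Markov chains given by a transition density k x y = p(y|x) w.r.t.   *)
(* a sigma-finite reference measure mu on the state space T, and an     *)
(* initial density q0 w.r.t. mu.                                        *)
Section MarkovDefs.
Context {R : realType} {dT : measure_display} {T : measurableType dT}.
Variable mu : {sigma_finite_measure set T -> \bar R}.

Fixpoint nstep (k : T -> T -> R) (n : nat) (g : T -> \bar R) (x : T) : \bar R :=
  match n with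
  | 0%N => g x
  | n'.+1 => \int[mu]_y ((k x y)%:E * nstep k n' g y)
  end.

Fixpoint path_step (k : T -> T -> R) (n : nat) (g : seq T -> \bar R)
    (past : seq T) (x : T) : \bar R :=
  match n with
  | 0%N => g (rcons past x)
  | n'.+1 => \int[mu]_y ((k x y)%:E * path_step k n' g (rcons past x) y)
  end.

(* Expectation of g(X_0,...,X_n) under P^(n): the law of (X_0,...,X_n), *)
(* whose density w.r.t. mu^{(n+1)} is q0(x_0) prod_i k x_{i-1} x_i.      *)
(* Paths are represented as sequences [:: x_0; ...; x_n].              *)
Definition chain_expect (q0 : T -> R) (k : T -> T -> R) (n : nat)
    (g : seq T -> \bar R) : \bar R :=
  \int[mu]_x0 ((q0 x0)%:E * path_step k n g [::] x0).

Fixpoint trans_prod (k : T -> T -> R) (s : seq T) : R :=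
  match s with
  | x :: ((y :: _) as s') => (k x y * trans_prod k s')%R
  | _ => 1%R
  end.

Definition joint_dens (q0 : T -> R) (k : T -> T -> R) (s : seq T) : R :=
  match s with
  | x :: _ => (q0 x * trans_prod k s)%R
  | [::] => 0%R
  end.

Definition llr (q0 : T -> R) (k0 k : T -> T -> R) (s : seq T) : R :=
  ln (joint_dens q0 k0 s / joint_dens q0 k s).

Definition KL_chain (q0 : T -> R) (k0 k : T -> T -> R) (n : nat) : \bar R :=
  chain_expect q0 k0 n (fun s => (llr q0 k0 k s)%:E).

Definition Var_chain (q0 : T -> R) (k0 k : T -> T -> R) (n : nat) : \bar R :=
  chain_expect q0 k0 n
    (fun s => ((llr q0 k0 k s - fine (KL_chain q0 k0 k n)) ^+ 2)%:E).

End MarkovDefs.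

Section KL.
Context {R : realType} {d : measure_display} {X : measurableType d}.
Definition KLdiv (nu pi : probability X R) : \bar R :=
  if pselect (nu `<< pi) is left _ then
    \int[pi]_x ((fine (Radon_Nikodym (charge_of_finite_measure nu) pi x)) *
                ln (fine (Radon_Nikodym (charge_of_finite_measure nu) pi x)))%:E
  else +oo.
End KL.

(* Main.v *)
Require Import Defs.
From HB Require Import structures.
From mathcomp Require Import all_boot all_order all_algebra.
From mathcomp Require Import all_classical all_reals all_analysis.
From mathcomp Require Import measurable_realfun ring lra.
Import Order.TTheory GRing.Theory Num.Theory.
Import numFieldNormedType.Exports.
Local Open Scope classical_set_scope.
Local Open Scope ring_scope.

(* Write the log-likelihood ratio as a sum of [g (X_i) (X_{i+1})] and let [P]
   be the transition operator of the chain under theta0, [G x] the conditional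
   mean of [g x X_1], and [F] the sum of the |f_k(theta, theta0)|.  Since
   |G| <= cst F V^(1/(2+delta)) with 1/(2+delta) < 1/2, interpolating between
   geometric ergodicity and a Jensen bound gives
   |P^n G - pi G| <= cst F sqrt(V) r^n with r < 1, so the remaining mean
   e_n = sum_(i < n) P^i G stays within cst F sqrt(V) of n pi G.  By the law of
   total variance each transition then adds at most cst F^2 V to the second
   moment, whence Var <= cst n F^2, while KL <= cst n F directly.  Finally
   F^2 <= m sum_k (|f_k| + |f_k|^(2+delta)) and the moment bounds on rho_n let
   eps_n = K / sqrt n work, for every delta.  The map from theta to KL or Var
   need not be measurable, so these bounds are integrated with
   [integral_le_ge0], which only uses the definition of the integral as a
   supremum over simple functions. *)

Lemma integral_le_ge0 (R : realType) (d : measure_display) (X : measurableType d)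
  (mu : {measure set X -> \bar R}) (f g : X -> \bar R) :
  (forall x, f x <= g x)%E -> (forall x, 0 <= g x)%E ->
  (\int[mu]_x f x <= \int[mu]_x g x)%E.
Proof.
move=> fg g0; rewrite (ge0_integralTE _ g0) integralE.
have h0 : (0 <= \int[mu]_x (f^\- x))%E by apply: integral_ge0.
(* Dropping the negative part only raises the integral. As [g] is nonnegative it dominates [f^\+],
   so every simple function below [f^\+] already competes in the supremum for [g]. *)
apply: (@le_trans _ _ (\int[mu]_x (f^\+ x))%E).
  by apply: geeDl; rewrite leeNl oppe0.
rewrite ge0_integralTE; last by move=> x; exact: funepos_ge0.
apply: le_ereal_sup => _ [h hf <-]; exists h => // x.
apply: le_trans (hf x) _.
by rewrite funeposE ge_max fg g0.
Qed.

(** * Expectations under a density *)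

Section WeightedExpectation.
Context {R : realType} {d : measure_display} {T : measurableType d}.
Variable mu : {measure set T -> \bar R}.

Definition density (w : T -> R) : Prop :=
  [/\ measurable_fun setT w, forall x, 0 <= w x & (\int[mu]_x (w x)%:E = 1)%E].

Definition wint (w h : T -> R) : Prop :=
  mu.-integrable setT (fun x => (w x * h x)%:E).

(** Real-valued, hence an honest expectation only alongside [wint]: [fine] sends infinite integrals
    to 0. *)
Definition wexp (w h : T -> R) : R := \int[mu]_x (w x * h x).

Lemma wexpE w h : wint w h -> (\int[mu]_x (w x * h x)%:E = (wexp w h)%:E)%E.
Proof.
by move=> wh; rewrite /wexp /Rintegral fineK//; exact: integrable_fin_num.
Qed.

Lemma wintZ w h c : wint w h -> wint w (fun x => c * h x).
Proof.
move=> /(integrableZl measurableT c); apply: eq_integrable => // x _.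
by rewrite -EFinM mulrCA.
Qed.

Lemma wexpZ w h c : wint w h -> wexp w (fun x => c * h x) = c * wexp w h.
Proof.
move=> wh; rewrite /wexp -RintegralZl//.
by apply: eq_Rintegral => x _; rewrite mulrCA.
Qed.

Lemma wintD w h1 h2 : wint w h1 -> wint w h2 ->
  wint w (fun x => h1 x + h2 x).
Proof.
move=> i1 i2; have := integrableD measurableT i1 i2.
by apply: eq_integrable => // x _; rewrite /= -EFinD mulrDr.
Qed.

Lemma wexpD w h1 h2 : wint w h1 -> wint w h2 ->
  wexp w (fun x => h1 x + h2 x) = wexp w h1 + wexp w h2.
Proof.
move=> i1 i2; rewrite /wexp -RintegralD//.
by apply: eq_Rintegral => x _; rewrite mulrDr.
Qed.

Lemma wint_sum w (I : Type) (s : seq I) (h : I -> T -> R) :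
  (forall i, wint w (h i)) -> wint w (fun x => \sum_(i <- s) h i x).
Proof.
move=> hi; elim: s => [|i s ih].
  under [X in wint w X]eq_fun do rewrite big_nil.
  apply: (@eq_integrable _ _ _ _ _ _ (cst 0%E)) => //.
    by move=> x _; rewrite mulr0.
  exact: integrable0.
under [X in wint w X]eq_fun do rewrite big_cons.
exact: wintD.
Qed.

Lemma wexp_sum w (I : Type) (s : seq I) (h : I -> T -> R) :
  (forall i, wint w (h i)) ->
  wexp w (fun x => \sum_(i <- s) h i x) = \sum_(i <- s) wexp w (h i).
Proof.
move=> hi; elim: s => [|i s ih].
  rewrite big_nil /wexp /Rintegral.
  under eq_integral do rewrite big_nil mulr0.
  by rewrite integral0.
rewrite big_cons -ih -wexpD//; last exact: wint_sum.
by apply: eq_Rintegral => x _; rewrite big_cons.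
Qed.

Lemma wint_dom (w h h' : T -> R) : density w -> measurable_fun setT h ->
  (forall x, `|h x| <= h' x) -> wint w h' -> wint w h.
Proof.
move=> [mw w0 _] mh hh'; apply: le_integrable => //.
  by apply/measurable_EFinP; exact: measurable_funM.
move=> x _; rewrite /= lee_fin !normrM ler_wpM2l//.
exact: le_trans (hh' x) (ler_norm _).
Qed.

Lemma wint_ge0 (w h : T -> R) : density w -> measurable_fun setT h ->
  (forall x, 0 <= h x) -> (\int[mu]_x (w x * h x)%:E < +oo)%E -> wint w h.
Proof.
move=> [mw w0 _] mh h0 hoo; apply/integrableP; split.
  by apply/measurable_EFinP; exact: measurable_funM.
under eq_integral => x _ do rewrite gee0_abs ?lee_fin ?mulr_ge0//.
exact: hoo.
Qed.

Lemma wint1 w : density w -> wint w (cst 1).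
Proof.
move=> dw; apply: wint_ge0 => //.
case: dw => _ _; under eq_integral do rewrite -[X in EFin X]mulr1.
by move=> ->; rewrite ltry.
Qed.

Lemma wexp1 w : density w -> wexp w (cst 1) = 1.
Proof.
move=> dw; rewrite /wexp /Rintegral; case: dw => _ _.
by under eq_integral do rewrite -[X in EFin X]mulr1; move=> ->.
Qed.

Lemma wint_cst w c : density w -> wint w (cst c).
Proof.
move=> dw; have := wintZ w (cst 1) c (wint1 w dw).
by apply: eq_integrable => // x _; rewrite /= mulr1.
Qed.

Lemma wexp_cst w c : density w -> wexp w (cst c) = c.
Proof.
move=> dw; rewrite -[RHS]mulr1 -[X in _ = c * X](wexp1 w dw) -wexpZ; last exact: wint1.
by apply: eq_Rintegral => x _; rewrite mulr1.
Qed.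

Lemma wexp_le (w h h' : T -> R) : density w -> wint w h -> wint w h' ->
  (forall x, h x <= h' x) -> wexp w h <= wexp w h'.
Proof.
move=> [_ w0 _] ih ih' hh'; apply: le_Rintegral => // x _.
by rewrite ler_wpM2l.
Qed.

Lemma wexp_ge0 (w h : T -> R) : density w -> (forall x, 0 <= h x) -> 0 <= wexp w h.
Proof. by move=> [_ w0 _] h0; apply: Rintegral_ge0 => x _; rewrite mulr_ge0. Qed.

Lemma wexp_norm (w h h' : T -> R) : density w -> wint w h -> wint w h' ->
  (forall x, `|h x| <= h' x) -> `|wexp w h| <= wexp w h'.
Proof.
move=> dw ih ih' hh'; rewrite ler_norml; apply/andP; split.
  rewrite lerNl -mulN1r -wexpZ//; apply: wexp_le => //; first exact: wintZ.
  by move=> x; rewrite mulN1r lerNl; have := hh' x; rewrite ler_norml => /andP[].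
by apply: wexp_le => // x; exact: le_trans (ler_norm _) (hh' x).
Qed.

End WeightedExpectation.

(** * Measurability of partial integrals, and inequalities for powers *)

Lemma measurable_integral_snd (R : realType) (d1 d2 : measure_display)
  (X : measurableType d1) (Y : measurableType d2)
  (mu : {sigma_finite_measure set Y -> \bar R}) (h : X * Y -> R) :
  measurable_fun setT h ->
  measurable_fun setT (fun x => \int[mu]_y (h (x, y)))%R.
Proof.
move=> mh; apply: (@measurableT_comp _ _ _ _ _ _ (@fine R)) => //.
(* Tonelli applies to the positive and negative parts separately, so [h] may fail to be
   integrable. *)
rewrite [X in measurable_fun _ X](_ : _ = (fun x =>
   \int[mu]_y ((EFin \o h)^\+ (x, y)) - \int[mu]_y ((EFin \o h)^\- (x, y)))%E);
  last first.
  apply/funext => x; rewrite integralE.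
  by congr (_ - _)%E; apply: eq_integral => y _; rewrite ?funeposE ?funenegE.
apply: emeasurable_funB.
- have := @measurable_fun_fubini_tonelli_F _ _ _ _ _ mu ((EFin \o h)^\+)%E.
  apply; last by move=> z; exact: funepos_ge0.
  by apply: measurable_funepos; exact/measurable_EFinP.
- have := @measurable_fun_fubini_tonelli_F _ _ _ _ _ mu ((EFin \o h)^\-)%E.
  apply; last by move=> z; exact: funeneg_ge0.
  by apply: measurable_funeneg; exact/measurable_EFinP.
Qed.

(** For [u <= L] monotonicity gives the first term; for [u > L] the factor [u^(al - 1)] is at most
    [L^(al - 1)], which gives the second. Being affine in [u], the bound passes through expectations
    and replaces Jensen up to a factor. *)
Lemma powR_le_affine (R : realType) (al L u : R) : 0 < al -> al < 1 ->
  0 < L -> 0 <= u -> u `^ al <= L `^ al + L `^ (al - 1) * u.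
Proof.
move=> al0 al1 L0 u0; have [uL|Lu] := leP u L.
  apply: (@le_trans _ _ (L `^ al)).
    by apply: ge0_ler_powR; rewrite ?nnegrE// ltW.
  by rewrite lerDl mulr_ge0// powR_ge0.
apply: (@le_trans _ _ (L `^ (al - 1) * u)); last first.
  by rewrite lerDr powR_ge0.
have up : 0 < u by exact: lt_trans L0 Lu.
have -> : al - 1 = - (1 - al) by ring.
rewrite powRN mulrC ler_pdivlMr ?powR_gt0//.
have uE : u `^ al * u `^ (1 - al) = u.
  rewrite -powRD; last by rewrite (gt_eqF up) implybT.
  by rewrite addrC subrK powRr1// ltW.
rewrite -[leRHS]uE ler_wpM2l ?powR_ge0//.
by apply: ge0_ler_powR; rewrite ?nnegrE ?subr_ge0// ltW.
Qed.

(** Split at [t * u = 1]. Below it, [t * u] is at most its square root and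
    [t^(1/2) <= t^(1/2 - al)]; above it, [(t * u)^(1/2 - al) >= 1], so
    [u^(al - 1/2) <= t^(1/2 - al)]. *)
Lemma powR_min_le (R : realType) (al t u : R) : 0 < al -> al < 2^-1 ->
  1 <= u -> 0 < t <= 1 ->
  (t * u <= Num.sqrt u * t `^ (2^-1 - al)) ||
  (u `^ al <= Num.sqrt u * t `^ (2^-1 - al)).
Proof.
move=> al0 al1 u1 /andP[t0 t1]; have u0 : 0 < u by exact: lt_le_trans u1.
have be0 : 0 <= 2^-1 - al by rewrite subr_ge0 ltW.
have tu0 : 0 <= t * u by rewrite mulr_ge0 ?(ltW t0) ?(ltW u0).
have [tu1|tu1] := leP (t * u) 1; apply/orP; [left|right].
  apply: (@le_trans _ _ (Num.sqrt (t * u))).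
    rewrite -[leLHS](sqr_sqrtr tu0) expr2 ler_piMl ?sqrtr_ge0//.
    by rewrite -[leRHS]sqrtr1 ler_wsqrtr.
  rewrite sqrtrM ?(ltW t0)// mulrC ler_wpM2l ?sqrtr_ge0//.
  by rewrite -powR12_sqrt ?(ltW t0)// ger_powR ?t0// lerBlDr lerDl ltW.
rewrite -powR12_sqrt ?(ltW u0)//.
have -> : u `^ al = u `^ 2^-1 * u `^ (al - 2^-1).
  by rewrite -powRD; [congr (_ `^ _); ring|rewrite (gt_eqF u0) implybT].
rewrite ler_wpM2l ?powR_ge0//.
have -> : al - 2^-1 = - (2^-1 - al) by ring.
rewrite powRN -[leLHS]mul1r ler_pdivrMr ?powR_gt0//.
rewrite -powRM ?(ltW t0) ?(ltW u0)//.
have {1}<- : 1 `^ (2^-1 - al) = 1 :> R by rewrite powR1.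
by apply: ge0_ler_powR; rewrite ?nnegrE ?ler01 ?[u * t]mulrC ?tu0 ?(ltW tu1).
Qed.

Lemma sum_geometric_le (R : realType) (r : R) n : 0 <= r < 1 ->
  \sum_(i < n) r ^+ i <= (1 - r)^-1.
Proof.
move=> /andP[r0 r1]; have r1' : 0 < 1 - r by rewrite subr_gt0.
rewrite -[leRHS]mul1r ler_pdivlMr//.
have -> : (\sum_(i < n) r ^+ i) * (1 - r) = 1 - r ^+ n.
  by rewrite -[RHS]opprB subrX1; ring.
by rewrite gerBl exprn_ge0.
Qed.

(** * The log-likelihood ratio along a growing path *)

Lemma trans_prod_rcons (R : realType) (d : measure_display) (T : measurableType d)
  (k : T -> T -> R) s x y :
  trans_prod k (rcons (rcons s x) y) = trans_prod k (rcons s x) * k x y.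
Proof.
elim: s => [|a [|b s] ih] /=; rewrite ?mulr1 ?mul1r//.
by move: ih => /= ->; rewrite mulrA.
Qed.

Lemma joint_dens_rcons (R : realType) (d : measure_display) (T : measurableType d)
  (q0 : T -> R) (k : T -> T -> R) s x y :
  joint_dens q0 k (rcons (rcons s x) y) = joint_dens q0 k (rcons s x) * k x y.
Proof.
have := trans_prod_rcons R d T k s x y.
by case: s => [|a s] h; rewrite /joint_dens ?rcons_cons -?rcons_cons h mulrA.
Qed.

Lemma llr_rcons (R : realType) (d : measure_display) (T : measurableType d)
  (q0 : T -> R) (k k' : T -> T -> R) s x y :
  0 < joint_dens q0 k (rcons s x) -> 0 < joint_dens q0 k' (rcons s x) ->
  0 < k x y -> 0 < k' x y ->
  llr q0 k k' (rcons (rcons s x) y) =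
  llr q0 k k' (rcons s x) + (ln (k x y) - ln (k' x y)).
Proof.
move=> h h' kx k'x; rewrite /llr !joint_dens_rcons -ln_div ?posrE//.
by rewrite -lnM ?posrE ?divr_gt0// mulf_div.
Qed.

(** * The transition operator on functions dominated by [V] *)

Section Kernel.
Context {R : realType} {d : measure_display} {T : measurableType d}.
Variable mu : {sigma_finite_measure set T -> \bar R}.
Variable k : T -> T -> R.
Hypothesis dk : forall x, density mu (k x).
Hypothesis mk : measurable_fun setT (fun xy : T * T => k xy.1 xy.2).

Definition Pop (f : T -> R) (x : T) : R := wexp mu (k x) f.

Lemma measurable_wexp (g : T -> T -> R) :
  measurable_fun setT (fun xy : T * T => g xy.1 xy.2) ->
  measurable_fun setT (fun x => wexp mu (k x) (g x)).
Proof.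
move=> mg.
apply: (@measurable_integral_snd _ _ _ _ _ mu (fun z => k z.1 z.2 * g z.1 z.2)).
exact: measurable_funM.
Qed.

Variables (V : T -> R) (B : R).
Hypothesis V1 : forall x, 1 <= V x.
Hypothesis mV : measurable_fun setT V.
Hypothesis B0 : 0 <= B.
Hypothesis kV : forall x, wint mu (k x) V.
Hypothesis PV : forall x, Pop V x <= B * V x.

(** The measurable functions in the ball of radius [c] of the [V]-weighted supremum norm. [Pop] maps
    such balls into such balls, and every density that integrates [V] integrates their elements. *)
Definition Vdom (c : R) (f : T -> R) : Prop :=
  measurable_fun setT f /\ forall x, `|f x| <= c * V x.

Let V0 x : 0 <= V x. Proof. exact: le_trans (V1 x). Qed.

Lemma Vdom_V : Vdom 1 V.
Proof. by split=> // x; rewrite mul1r ger0_norm. Qed.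

Lemma Vdom_wint w c f : density mu w -> wint mu w V -> Vdom c f -> wint mu w f.
Proof.
move=> dw wV [mf fV]; apply: (wint_dom mu w f (fun x => c * V x)) => //.
exact: wintZ.
Qed.

Lemma Vdom_Pop c f : Vdom c f -> Vdom (c * B) (Pop f).
Proof.
move=> hf; split.
  apply: (measurable_wexp (fun _ => f)).
  by apply: measurableT_comp; [case: hf|].
move=> x; have c0 : 0 <= c.
  have [_ /(_ x) h] := hf.
  have : 0 <= c * V x by exact: le_trans h.
  by rewrite pmulr_lge0// (lt_le_trans _ (V1 x)).
apply: (@le_trans _ _ (wexp mu (k x) (fun y => c * V y))).
  apply: wexp_norm => //; [exact: Vdom_wint hf|exact: wintZ|by case: hf].
by rewrite wexpZ// -mulrA ler_wpM2l// PV.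
Qed.

Lemma Vdom_iter c f n : Vdom c f -> Vdom (c * B ^+ n) (iter n Pop f).
Proof.
move=> hf; elim: n => [|n ih] /=; first by rewrite mulr1.
by rewrite exprSr mulrA; exact: Vdom_Pop.
Qed.

(** Domination by [V] keeps all the nested integrals finite, so the extended-real recursion can be
    traded for iterates of a real operator. *)
Lemma nstep_iter c f n x : Vdom c f ->
  nstep mu k n (fun y => (f y)%:E) x = (iter n Pop f x)%:E.
Proof.
move=> hf; elim: n x => [|n ih] x //=.
under eq_integral do rewrite ih.
exact: wexpE (Vdom_wint _ _ _ (dk x) (kV x) (Vdom_iter _ _ n hf)).
Qed.

Lemma iter_PopZ a c f n x : Vdom c f ->
  iter n Pop (fun y => a * f y) x = a * iter n Pop f x.
Proof.
move=> hf; elim: n x => [|n ih] x //=.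
rewrite /Pop -wexpZ; last exact: Vdom_wint (Vdom_iter _ _ n hf).
by congr (wexp mu _ _); apply/funext => y; rewrite ih.
Qed.

(** [Pop] is positive and fixes constants, so affine bounds in [V] propagate. *)
Lemma iter_Pop_norm_le c' f b c n x : Vdom c' f ->
  (forall y, `|f y| <= b + c * V y) ->
  `|iter n Pop f x| <= b + c * iter n Pop V x.
Proof.
move=> hf fb; elim: n x => [|n ih] x //=.
have iV : wint mu (k x) (iter n Pop V).
  exact: Vdom_wint (Vdom_iter _ _ n Vdom_V).
have ib : wint mu (k x) (cst b) by exact: wint_cst.
rewrite {2}/Pop -wexpZ// -{1}(wexp_cst mu (k x) b)// -wexpD//; last exact: wintZ.
apply: wexp_norm => //; last by apply: wintD => //; exact: wintZ.
exact: Vdom_wint (Vdom_iter _ _ n hf).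
Qed.

(** Expected value of f(X_0) + ... + f(X_(n-1)) for the chain started at [x]. For f the step mean it
    is the expected log-likelihood ratio still to be collected. *)
Definition psum (n : nat) (f : T -> R) (x : T) : R := \sum_(i < n) iter i Pop f x.

Lemma wint_iter c f i w : density mu w -> wint mu w V ->
  Vdom c f -> wint mu w (iter i Pop f).
Proof. by move=> dw wV hf; exact: Vdom_wint (Vdom_iter _ _ i hf). Qed.

Lemma wint_psum c f n w : density mu w -> wint mu w V ->
  Vdom c f -> wint mu w (psum n f).
Proof. by move=> dw wV hf; apply: wint_sum => i; exact: wint_iter hf. Qed.

Lemma measurable_psum c f n : Vdom c f -> measurable_fun setT (psum n f).
Proof.
move=> hf; apply: (@measurable_sum _ _ _ _ _ _ (fun i : 'I_n => iter i Pop f)).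
by move=> i; case: (Vdom_iter _ _ i hf).
Qed.

Lemma psumS c f n x : Vdom c f -> psum n.+1 f x = f x + Pop (psum n f) x.
Proof.
move=> hf; rewrite /psum big_ord_recl /=; congr (_ + _).
rewrite /Pop wexp_sum// => i; exact: wint_iter hf.
Qed.

(** * Mixing bounds derived from geometric ergodicity *)

Variables (q : T -> R) (Rc tau al : R).
Hypothesis dq : density mu q.
Hypothesis qV : wint mu q V.
Hypothesis Rc0 : 0 <= Rc.
Hypothesis tau01 : 0 < tau < 1.
Hypothesis al01 : 0 < al < 2^-1.
Hypothesis VB : forall n x, iter n Pop V x <= B * V x.
Hypothesis geo : forall f : T -> R, measurable_fun setT f -> (forall y, `|f y| <= V y) ->
  forall x n, `|iter n Pop f x - wexp mu q f| <= Rc * V x * tau ^+ n.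

Lemma psum_norm_le a f n x : 0 <= a ->
  Vdom a f -> `|psum n f x| <= n%:R * (a * B * V x).
Proof.
move=> a0 hf; apply: le_trans (ler_norm_sum _ _ _) _.
rewrite -[X in X%:R]card_ord -sum1_card natr_sum mulr_suml ler_sum// => i _.
rewrite mul1r; apply: (@le_trans _ _ (0 + a * iter i Pop V x)).
  by apply: (iter_Pop_norm_le _ _ _ _ _ _ hf) => y; rewrite add0r; case: hf.
by rewrite add0r -mulrA ler_wpM2l.
Qed.

Lemma geo_scaled a (f : T -> R) n x : 0 <= a -> Vdom a f ->
  `|iter n Pop f x - wexp mu q f| <= a * (Rc * V x * tau ^+ n).
Proof.
rewrite le_eqVlt => /predU1P[<- [_ hf]|a0 hf].
  (* A zero radius cannot be divided out, but it forces [f] to vanish. *)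
  have f0 : f = fun y => 0 * V y.
    apply/funext => y; rewrite mul0r; apply/eqP; rewrite -normr_le0.
    by have := hf y; rewrite mul0r.
  by rewrite f0 (iter_PopZ 0 1)// ?wexpZ// ?mul0r ?subr0 ?normr0//; exact: Vdom_V.
have [mf fV] := hf.
have := geo (fun y => a^-1 * f y) _ _ x n.
rewrite (iter_PopZ a^-1 a)// wexpZ//; last exact: Vdom_wint hf.
rewrite -mulrBr normrM gtr0_norm ?invr_gt0// ler_pdivrMl//; apply.
  exact: measurable_funM.
by move=> y; rewrite normrM gtr0_norm ?invr_gt0// ler_pdivrMl.
Qed.

(** The part of the rate [tau] that survives the interpolation; it is below 1 because [al < 1/2]. *)
Definition mixrate : R := tau `^ (2^-1 - al).
Definition mixcst : R := Rc + 2 + B + wexp mu q V.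

Let wqV0 : 0 <= wexp mu q V. Proof. exact: wexp_ge0. Qed.

Lemma mixcst_ge0 : 0 <= mixcst.
Proof. by rewrite /mixcst !addr_ge0. Qed.

Lemma mixrate01 : 0 <= mixrate < 1.
Proof.
have /andP[al0 al1] := al01; have /andP[tau0 tau1] := tau01.
rewrite powR_ge0/= -[ltRHS](powRr0 tau) /mixrate.
rewrite /powR gt_eqF// mul0r expR0 expR_lt1 pmulr_rlt0 ?subr_gt0//.
by rewrite ln_lt0// tau0.
Qed.

Lemma powal_le_V y : V y `^ al <= V y.
Proof.
by rewrite ler1_powR//; have /andP[_ /ltW/le_trans] := al01; apply; lra.
Qed.

Lemma Vdom_powal a (f : T -> R) : 0 <= a -> measurable_fun setT f ->
  (forall y, `|f y| <= a * V y `^ al) -> Vdom a f.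
Proof.
move=> a0 mf hf; split=> // y; apply: le_trans (hf y) _.
by rewrite ler_wpM2l// powal_le_V.
Qed.

(* Interpolates between the two bounds [a Rc V tau^n] (ergodicity) and
   [a (2 + B + wexp mu q V) V^al] (Jensen in the affine form
   [u^al <= L^al + L^(al - 1) u] with [L = V x]). *)
Lemma sqrt_mixing a (f : T -> R) n x : 0 <= a -> measurable_fun setT f ->
  (forall y, `|f y| <= a * V y `^ al) ->
  `|iter n Pop f x - wexp mu q f|
    <= a * mixcst * Num.sqrt (V x) * mixrate ^+ n.
Proof.
move=> a0 mf hf; have hV := Vdom_powal a f a0 mf hf.
have /andP[al0 al1] := al01; have /andP[tau0 tau1] := tau01.
have Vx : 0 < V x by exact: lt_le_trans (V1 x).
have al11 : al < 1 by apply: lt_trans al1 _; lra.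
have qf : wint mu q f by exact: Vdom_wint hV.
(* Affine majorant with [L = V x]. Since [c * V x = b], the iterate is at most [b + B * b] and the
   stationary mean at most [b + b * wexp mu q V], which explains [2 + B + wexp mu q V] in
   [mixcst]. *)
pose b := a * V x `^ al; pose c := a * V x `^ (al - 1).
have fbc y : `|f y| <= b + c * V y.
  apply: le_trans (hf y) _; rewrite /b /c -mulrA -mulrDr ler_wpM2l//.
  by apply: powR_le_affine.
have c0 : 0 <= c by rewrite mulr_ge0// powR_ge0.
have cVx : c * V x = b.
  rewrite /c /b -mulrA; congr (_ * _).
  by rewrite mulrC mulr_powRB1// ltW.
have b0 : 0 <= b by rewrite mulr_ge0// powR_ge0.
have h1 := geo_scaled a f n x a0 hV.
have h2 : `|iter n Pop f x - wexp mu q f| <= a * mixcst * V x `^ al.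
  apply: le_trans (ler_normB _ _) _.
  have := iter_Pop_norm_le a f b c n x hV fbc.
  have : c * iter n Pop V x <= B * b.
    by rewrite -cVx mulrCA ler_wpM2l.
  have : `|wexp mu q f| <= b + c * wexp mu q V.
    rewrite -wexpZ// -{1}(wexp_cst mu q b)// -wexpD//; last first.
    - exact: wintZ.
    - exact: wint_cst.
    apply: wexp_norm => //.
    by apply: wintD; [exact: wint_cst|exact: wintZ].
  have : c * wexp mu q V <= b * wexp mu q V.
    by rewrite ler_wpM2r// -cVx ler_peMr.
  have -> : a * mixcst * V x `^ al = b * Rc + b + b + B * b + b * wexp mu q V.
    by rewrite /mixcst /b; ring.
  have : 0 <= b * Rc by rewrite mulr_ge0.
  lra.
have -> : a * mixcst * Num.sqrt (V x) * mixrate ^+ n =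
          a * mixcst * (Num.sqrt (V x) * (tau ^+ n) `^ (2^-1 - al)).
  by rewrite /mixrate -!powR_mulrn ?powR_ge0 ?(ltW tau0)// powRAC; ring.
have tn : 0 < tau ^+ n <= 1 by rewrite exprn_gt0//= exprn_ile1// ltW.
have ac : 0 <= a * mixcst by rewrite mulr_ge0// mixcst_ge0.
(* With [t = tau^n] and [u = V x], one of the bounds [h1] and [h2] is always good enough. *)
case/orP: (powR_min_le R al _ _ al0 al1 (V1 x) tn) => hs.
  apply: le_trans h1 _; apply: (@le_trans _ _ (a * mixcst * (tau ^+ n * V x))).
    rewrite -[leRHS]mulrA; apply: ler_wpM2l => //.
    rewrite -[leLHS]mulrA [V x * _]mulrC; apply: ler_wpM2r.
      by rewrite mulr_ge0// exprn_ge0// ltW.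
    by rewrite /mixcst -!addrA lerDl !addr_ge0.
  by rewrite ler_wpM2l.
by apply: le_trans h2 _; rewrite ler_wpM2l.
Qed.

Definition sumcst : R := mixcst / (1 - mixrate).

Lemma sumcst_ge0 : 0 <= sumcst.
Proof.
have /andP[_ /ltW r1] := mixrate01.
by rewrite divr_ge0 ?mixcst_ge0// subr_ge0.
Qed.

(** The errors of [sqrt_mixing] form a geometric series, so the bound does not grow with [n]. *)
Lemma psum_mixing a (f : T -> R) n x : 0 <= a -> measurable_fun setT f ->
  (forall y, `|f y| <= a * V y `^ al) ->
  `|psum n f x - n%:R * wexp mu q f| <= a * sumcst * Num.sqrt (V x).
Proof.
move=> a0 mf hf.
have -> : psum n f x - n%:R * wexp mu q f =
    \sum_(i < n) (iter i Pop f x - wexp mu q f).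
  rewrite big_split /= sumr_const card_ord /psum; congr (_ + _).
  by rewrite mulNrn mulr_natl.
apply: le_trans (ler_norm_sum _ _ _) _.
apply: (@le_trans _ _ (\sum_(i < n) a * mixcst * Num.sqrt (V x) * mixrate ^+ i)).
  by apply: ler_sum => i _; exact: sqrt_mixing.
have -> : a * sumcst * Num.sqrt (V x) =
    a * mixcst * Num.sqrt (V x) * (1 - mixrate)^-1 by rewrite /sumcst; ring.
rewrite -mulr_sumr ler_wpM2l//.
  by rewrite !mulr_ge0// ?mixcst_ge0 ?sqrtr_ge0.
by apply: sum_geometric_le; exact: mixrate01.
Qed.

(** * Mean and second moment contributed by one transition *)

Variables (g N : T -> T -> R) (F cN : R).
Hypothesis mg : measurable_fun setT (fun xy : T * T => g xy.1 xy.2).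
Hypothesis F0 : 0 <= F.
Hypothesis cN0 : 0 <= cN.
Hypothesis gN : forall x y, `|g x y| <= F * N x y.
Hypothesis kN : forall x, wint mu (k x) (N x).
Hypothesis kN2 : forall x, wint mu (k x) (fun y => N x y ^+ 2).
Hypothesis N1V : forall x, wexp mu (k x) (N x) <= cN * V x `^ al.
Hypothesis N2V : forall x, wexp mu (k x) (fun y => N x y ^+ 2) <= cN * V x.

Definition step_mean (x : T) : R := wexp mu (k x) (g x).

Let mgx x : measurable_fun setT (g x).
Proof. exact: (measurableT_comp mg (pair1_measurable x)). Qed.

Let FcN0 : 0 <= F * cN. Proof. exact: mulr_ge0. Qed.

Let kg x : wint mu (k x) (g x).
Proof.
by apply: (wint_dom mu (k x) (g x) (fun y => F * N x y)) => //; exact: wintZ.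
Qed.

Lemma measurable_step_mean : measurable_fun setT step_mean.
Proof. exact: measurable_wexp. Qed.

Lemma step_mean_le x : `|step_mean x| <= F * cN * V x `^ al.
Proof.
apply: (@le_trans _ _ (wexp mu (k x) (fun y => F * N x y))).
  by apply: wexp_norm => //; exact: wintZ.
by rewrite wexpZ// -mulrA ler_wpM2l.
Qed.

Lemma Vdom_step_mean : Vdom (F * cN) step_mean.
Proof. by apply: Vdom_powal => //; [exact: measurable_step_mean|exact: step_mean_le]. Qed.

Lemma step_mean_mixing n x :
  `|psum n step_mean x - n%:R * wexp mu q step_mean| <= F * cN * sumcst * Num.sqrt (V x).
Proof.
by apply: psum_mixing => //; [exact: measurable_step_mean|exact: step_mean_le].
Qed.

(** This is where the square root pays off: squaring gives [V], which is integrable, and not a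
    higher power of it. *)
Lemma step_mean_mixing_sqr n x :
  (psum n step_mean x - n%:R * wexp mu q step_mean) ^+ 2 <= (F * cN * sumcst) ^+ 2 * V x.
Proof.
rewrite -[in leRHS](sqr_sqrtr (V0 x)) -exprMn -real_normK ?num_real//.
rewrite lerXn2r ?nnegrE ?step_mean_mixing//.
by rewrite mulr_ge0 ?sqrtr_ge0// mulr_ge0 ?sumcst_ge0// mulr_ge0.
Qed.

(** From [(g + e)^2 <= 2 g^2 + 2 e^2]: the first term comes from [N2V], the second from the squared
    mixing error [e] averaged with [PV]. *)
Definition stepvar : R := 2 * cN + 2 * (cN * sumcst) ^+ 2 * B.

Lemma stepvar_ge0 : 0 <= stepvar.
Proof.
have := mulr_ge0 (sqr_ge0 (cN * sumcst)) B0.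
by rewrite /stepvar -mulrA; move: (_ * B) => X; have := cN0; lra.
Qed.

(** Martingale identity: the ratio collected so far plus the expected remainder has zero drift. *)
Lemma wexp_add_psum n x :
  wexp mu (k x) (fun y => g x y + psum n step_mean y) = psum n.+1 step_mean x.
Proof.
rewrite wexpD//; last by apply: wint_psum => //; exact: Vdom_step_mean.
by rewrite (psumS (F * cN))//; exact: Vdom_step_mean.
Qed.

Lemma wint_add_psum n x :
  wint mu (k x) (fun y => g x y + psum n step_mean y).
Proof. by apply: wintD => //; apply: wint_psum => //; exact: Vdom_step_mean. Qed.

(* Conditional variances are bounded by the second moment around
   [n * wexp mu q step_mean], which is where the mixing estimate enters. *)
Lemma second_moment_step n x s :
  wint mu (k x) (fun y => (s + g x y + psum n step_mean y) ^+ 2) /\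
  wexp mu (k x) (fun y => (s + g x y + psum n step_mean y) ^+ 2) <=
    (s + psum n.+1 step_mean x) ^+ 2 + F ^+ 2 * stepvar * V x.
Proof.
pose c := n%:R * wexp mu q step_mean.
pose Z y := g x y + psum n step_mean y - c.
have mZ : measurable_fun setT Z.
  apply: measurable_funB => //; apply: measurable_funD => //.
  by apply: measurable_psum; exact: Vdom_step_mean.
pose D y := 2 * F ^+ 2 * N x y ^+ 2 + 2 * (F * cN * sumcst) ^+ 2 * V y.
have iD : wint mu (k x) D by apply: wintD; exact: wintZ.
have ZD y : Z y ^+ 2 <= D y.
  have h : g x y ^+ 2 <= F ^+ 2 * N x y ^+ 2.
    rewrite -exprMn -real_normK ?num_real// lerXn2r ?nnegrE//.
    exact: le_trans (gN x y).
  have := step_mean_mixing_sqr n y; rewrite -/c /D.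
  have -> : Z y = g x y + (psum n step_mean y - c) by rewrite /Z addrA.
  move: (psum n step_mean y - c) => e he.
  have := sqr_ge0 (g x y - e); nra.
have iZ2 : wint mu (k x) (fun y => Z y ^+ 2).
  apply: (wint_dom _ _ _ D) => //; first exact: measurable_funX.
  by move=> y; rewrite ger0_norm ?sqr_ge0.
have iZ : wint mu (k x) Z.
  apply: wintD; first exact: wint_add_psum.
  exact: wint_cst.
have eZ : wexp mu (k x) Z = psum n.+1 step_mean x - c.
  rewrite /Z wexpD; [|exact: wint_add_psum|exact: wint_cst].
  by rewrite wexp_add_psum wexp_cst.
have eq1 y : (s + g x y + psum n step_mean y) ^+ 2 =
    (s + c) ^+ 2 + 2 * (s + c) * Z y + Z y ^+ 2 by rewrite /Z; ring.
rewrite (eq_fun eq1); split.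
  by apply: wintD => //; apply: wintD; [exact: wint_cst|exact: wintZ].
rewrite wexpD//; last by apply: wintD; [exact: wint_cst|exact: wintZ].
rewrite wexpD//; [|exact: wint_cst|exact: wintZ].
rewrite wexp_cst// wexpZ// eZ.
have : wexp mu (k x) (fun y => Z y ^+ 2) <= F ^+ 2 * stepvar * V x.
  apply: (@le_trans _ _ (wexp mu (k x) D)); first exact: wexp_le.
  rewrite /D wexpD; [|exact: wintZ|exact: wintZ]; rewrite !wexpZ//.
  have -> : F ^+ 2 * stepvar * V x = 2 * F ^+ 2 * (cN * V x) +
      2 * (F * cN * sumcst) ^+ 2 * (B * V x) by rewrite /stepvar; ring.
  apply: lerD; apply: ler_wpM2l.
  - by apply: mulr_ge0 => //; exact: sqr_ge0.
  - exact: N2V.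
  - by apply: mulr_ge0 => //; exact: sqr_ge0.
  - exact: PV.
(* Expanding the target square about [s + c] yields the same constant and cross terms plus the
   square of [psum n.+1 step_mean x - c], which may be dropped. *)
have := sqr_ge0 (psum n.+1 step_mean x - c); nra.
Qed.

(** * Divergence and variance of the whole path *)

Variables (q0 : T -> R) (k' : T -> T -> R).
Hypothesis dq0 : density mu q0.
Hypothesis q0V : wint mu q0 V.
Hypothesis k_gt0 : forall x y, 0 < k x y.
Hypothesis k'_gt0 : forall x y, 0 < k' x y.
Hypothesis gE : forall x y, g x y = ln (k x y) - ln (k' x y).

Lemma path_step_llr n past x :
  0 < joint_dens q0 k (rcons past x) -> 0 < joint_dens q0 k' (rcons past x) ->
  path_step mu k n (fun s => (llr q0 k k' s)%:E) past x =
  (llr q0 k k' (rcons past x) + psum n step_mean x)%:E.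
Proof.
elim: n past x => [|n ih] past x h h' /=; first by rewrite /psum big_ord0 addr0.
under eq_integral.
  move=> y _; rewrite ih ?joint_dens_rcons ?mulr_gt0// llr_rcons// -gE -addrA.
  over.
set c := llr _ _ _ _.
rewrite [LHS](wexpE mu (k x) (fun y => c + (g x y + psum n step_mean y))).
  rewrite wexpD; [|exact: wint_cst|exact: wint_add_psum].
  by rewrite wexp_cst// wexp_add_psum.
by apply: wintD; [exact: wint_cst|exact: wint_add_psum].
Qed.

(** The law of total variance, iterated. Each transition costs a multiple of [V] at its starting
    state, and [psum n V] collects the expected costs. *)
Lemma path_step_sqr_le n past x c :
  0 < joint_dens q0 k (rcons past x) -> 0 < joint_dens q0 k' (rcons past x) ->
  (path_step mu k n (fun s => ((llr q0 k k' s - c) ^+ 2)%:E) past x <=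
  ((llr q0 k k' (rcons past x) - c + psum n step_mean x) ^+ 2 +
   F ^+ 2 * stepvar * psum n V x)%:E)%E.
Proof.
have A0 : 0 <= F ^+ 2 * stepvar by rewrite mulr_ge0 ?sqr_ge0 ?stepvar_ge0.
have iterV_ge0 i y : 0 <= iter i Pop V y.
  elim: i y => [|i ih] y /=; first exact: V0.
  by apply: wexp_ge0.
elim: n past x => [|n ih] past x h h' /=.
  by rewrite /psum !big_ord0 !addr0 mulr0 addr0.
set s := llr _ _ _ _ - c.
pose G y := (s + g x y + psum n step_mean y) ^+ 2 + F ^+ 2 * stepvar * psum n V y.
have G0 y : 0 <= G y.
  rewrite /G addr_ge0 ?sqr_ge0// mulr_ge0//; apply: sumr_ge0 => i _.
  exact: iterV_ge0.
(* The inner integral is only bounded above, without measurability in [y], hence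
   [integral_le_ge0]. *)
apply: (@le_trans _ _ (\int[mu]_y (k x y * G y)%:E)%E).
  apply: integral_le_ge0 => y; last by rewrite lee_fin mulr_ge0// ltW.
  rewrite EFinM; apply: lee_wpmul2l; first by rewrite lee_fin ltW.
  apply: le_trans (ih _ _ _ _) _; rewrite ?joint_dens_rcons ?mulr_gt0//.
  by rewrite llr_rcons// -gE /G /s lee_fin [_ + g x y - c]addrAC.
have [i2 m2] := second_moment_step n x s.
have iVn : wint mu (k x) (psum n V) by apply: wint_psum => //; exact: Vdom_V.
rewrite wexpE; last by apply: wintD => //; exact: wintZ.
rewrite lee_fin wexpD//; last exact: wintZ.
rewrite wexpZ// (psumS 1 V)//; last exact: Vdom_V.
by rewrite [leRHS](congr1 (+%R _) (mulrDr _ (V x) _)) addrA lerD2r.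
Qed.

(** The common initial density cancels. This also starts the positivity of joint densities that is
    carried along paths. *)
Lemma chain_llr_singleton x : 0 < q0 x ->
  [/\ 0 < joint_dens q0 k [:: x], 0 < joint_dens q0 k' [:: x] &
      llr q0 k k' [:: x] = 0].
Proof.
move=> qx; rewrite /llr /joint_dens /= !mulr1; split=> //.
by rewrite divff ?gt_eqF// ln1.
Qed.

Lemma q0_ge0 x : 0 <= q0 x. Proof. by case: dq0. Qed.

Lemma wint_psum_step_mean n : wint mu q0 (psum n step_mean).
Proof. by apply: wint_psum => //; exact: Vdom_step_mean. Qed.

Lemma KL_chainE n : KL_chain mu q0 k k' n = (wexp mu q0 (psum n step_mean))%:E.
Proof.
rewrite /KL_chain /chain_expect -wexpE; last exact: wint_psum_step_mean.
apply: eq_integral => x _.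
(* Where [q0] vanishes the log ratio is a junk value, but it is multiplied by 0. *)
have := q0_ge0 x; rewrite le_eqVlt => /predU1P[<-|qx]; first by rewrite mul0e mul0r.
have [h h' l0] := chain_llr_singleton x qx.
by rewrite path_step_llr//= l0 add0r.
Qed.

Lemma KL_chain_le n :
  (KL_chain mu q0 k k' n <= (n%:R * (cN * B * wexp mu q0 V) * F)%:E)%E.
Proof.
rewrite KL_chainE lee_fin.
have -> : n%:R * (cN * B * wexp mu q0 V) * F =
    wexp mu q0 (fun x => n%:R * (F * cN * B) * V x) by rewrite wexpZ//; ring.
apply: wexp_le => //; [exact: wint_psum_step_mean|exact: wintZ|move=> x].
apply: le_trans (ler_norm _) _; rewrite -mulrA.
by apply: psum_norm_le => //; exact: Vdom_step_mean.
Qed.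

(** The first term accounts for the randomness of the starting state, the second for the
    transitions. *)
Definition varcst : R := ((cN * sumcst) ^+ 2 + stepvar * B) * wexp mu q0 V.

Lemma varcst_ge0 : 0 <= varcst.
Proof.
rewrite mulr_ge0 ?wexp_ge0// addr_ge0 ?sqr_ge0// mulr_ge0//.
exact: stepvar_ge0.
Qed.

Lemma Var_chain_le n : (0 < n)%N ->
  (Var_chain mu q0 k k' n <= (n%:R * varcst * F ^+ 2)%:E)%E.
Proof.
move=> n0; rewrite /Var_chain KL_chainE /= /chain_expect.
set kap := wexp mu q0 _.
have A0 : 0 <= F ^+ 2 * stepvar by rewrite mulr_ge0 ?sqr_ge0 ?stepvar_ge0.
pose c := n%:R * wexp mu q step_mean.
pose Z x := psum n step_mean x - c.
pose D x := (F * cN * sumcst) ^+ 2 * V x.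
pose W x := F ^+ 2 * stepvar * (n%:R * B * V x).
(* Mixing controls the deviation from [c], not from the mean [kap]. Since [Z] has mean [kap - c],
   the first two terms integrate to [- (c - kap)^2 <= 0]. *)
pose G x := (c - kap) ^+ 2 + 2 * (c - kap) * Z x + D x + W x.
have hG x : (psum n step_mean x - kap) ^+ 2 + F ^+ 2 * stepvar * psum n V x <= G x.
  have -> : psum n step_mean x - kap = (c - kap) + Z x by rewrite /Z; ring.
  apply: lerD.
    have -> : (c - kap + Z x) ^+ 2 =
        (c - kap) ^+ 2 + 2 * (c - kap) * Z x + Z x ^+ 2 by ring.
    by rewrite lerD2l; exact: step_mean_mixing_sqr.
  apply: ler_wpM2l => //; apply: le_trans (ler_norm _) _.
  rewrite -mulrA -[B]mul1r; apply: psum_norm_le => //; exact: Vdom_V.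
have iG2 x : 0 <= G x.
  apply: le_trans (hG x); rewrite addr_ge0 ?sqr_ge0// mulr_ge0//.
  apply: sumr_ge0 => i _; elim: (i : nat) x => [|j ih] x /=; first exact: V0.
  exact: wexp_ge0.
apply: (@le_trans _ _ (\int[mu]_x (q0 x * G x)%:E)%E).
  apply: integral_le_ge0 => x; last by rewrite lee_fin mulr_ge0// q0_ge0.
  have := q0_ge0 x; rewrite le_eqVlt => /predU1P[<-|qx].
    by rewrite mul0e mul0r.
  have [h h' l0] := chain_llr_singleton x qx.
  rewrite EFinM; apply: lee_wpmul2l; first by rewrite lee_fin ltW.
  apply: le_trans (path_step_sqr_le n [::] x kap h h') _.
  by rewrite /= l0 lee_fin add0r addrC [- kap + _]addrC addrC.
have iZ : wint mu q0 Z.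
  by apply: wintD; [exact: wint_psum_step_mean|exact: wint_cst].
have eZ : wexp mu q0 Z = kap - c.
  rewrite /Z wexpD; [|exact: wint_psum_step_mean|exact: wint_cst].
  by rewrite wexp_cst.
have iD : wint mu q0 D by exact: wintZ.
have iW : wint mu q0 W by do 2 apply: wintZ.
have iL : wint mu q0 (fun x => 2 * (c - kap) * Z x) by exact: wintZ.
have iC : wint mu q0 (cst ((c - kap) ^+ 2)) by exact: wint_cst.
rewrite wexpE; last by do 3 apply: wintD => //.
rewrite lee_fin wexpD//; last by do 2 apply: wintD => //.
rewrite wexpD//; last by apply: wintD.
rewrite wexpD// wexp_cst// wexpZ// eZ !wexpZ//; last exact: wintZ.
have D0 : 0 <= wexp mu q0 V by exact: wexp_ge0.
have n1 : 1 <= n%:R :> R by rewrite ler1n.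
have p1 := mulr_ge0 (sqr_ge0 (F * cN * sumcst)) D0.
have -> : n%:R * varcst * F ^+ 2 = n%:R * ((F * cN * sumcst) ^+ 2 * wexp mu q0 V)
   + F ^+ 2 * stepvar * (n%:R * B * wexp mu q0 V) by rewrite /varcst; ring.
rewrite lerD2r; move: p1; set p := (_ ^+ 2 * wexp mu q0 V) => p1.
(* The starting-state term does not grow with [n]; [n >= 1] absorbs it into the linear bound. *)
have : p <= n%:R * p by rewrite ler_peMl.
have := sqr_ge0 (c - kap); move: (n%:R * p) => np; nra.
Qed.

End Kernel.

(** * Moment inequalities for the envelope and for the prior integrals *)

Lemma sqr_sum_le (R : realType) (n : nat) (a : 'I_n -> R) :
  (\sum_i a i) ^+ 2 <= n%:R * \sum_i a i ^+ 2.
Proof.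
have -> : n%:R * \sum_i a i ^+ 2 =
    \sum_(i < n) \sum_(j < n) (2^-1 * a i ^+ 2 + 2^-1 * a j ^+ 2).
  transitivity (\sum_(i < n) (n%:R * (2^-1 * a i ^+ 2) +
                              2^-1 * \sum_(j < n) a j ^+ 2)).
    rewrite big_split /= sumr_const card_ord -mulr_natl -!mulr_sumr.
    by set S := \sum_i _; lra.
  apply: eq_bigr => i _.
  by rewrite big_split /= sumr_const card_ord mulr_natl -mulr_sumr.
rewrite expr2 big_distrlr /=; apply: ler_sum => i _; apply: ler_sum => j _.
have := sqr_ge0 (a i - a j); nra.
Qed.

(** Keeps [u], not 1, on the right: both terms then have moments under [rho n] that decay at least
    like [1 / sqrt n]. *)
Lemma sqr_le_addr_powR (R : realType) (e u : R) : 0 <= e -> 0 <= u ->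
  u ^+ 2 <= u + u `^ (2 + e).
Proof.
move=> e0 u0; have [u1|/ltW u1] := leP u 1.
  apply: (@le_trans _ _ u); last by rewrite lerDl powR_ge0.
  by rewrite expr2 ler_piMl.
apply: (@le_trans _ _ (u `^ (2 + e))); last by rewrite lerDr.
by rewrite -powR_mulrn// ler_powR// lerDl.
Qed.

Lemma sqr_le_1_powR (R : realType) (e u : R) : 0 <= e -> 0 <= u ->
  u ^+ 2 <= 1 + u `^ (2 + e).
Proof.
move=> e0 u0; have [u1|/ltW u1] := leP u 1.
  apply: (@le_trans _ _ 1); last by rewrite lerDl powR_ge0.
  by rewrite exprn_ile1.
apply: (@le_trans _ _ (u `^ (2 + e))); last by rewrite lerDr.
by rewrite -powR_mulrn// ler_powR// lerDl.
Qed.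

Lemma integral_scaled_sum_le (R : realType) (d : measure_display)
  (X : measurableType d) (nu : {measure set X -> \bar R}) (n : nat)
  (h : 'I_n -> X -> R) (c b : R) :
  0 <= c -> (forall i, measurable_fun setT (h i)) ->
  (forall i x, 0 <= h i x) -> (forall i, \int[nu]_x (h i x)%:E <= b%:E)%E ->
  (\int[nu]_x (c * \sum_i h i x)%:E <= (c * (n%:R * b))%:E)%E.
Proof.
move=> c0 mh h0 hb.
under eq_integral do rewrite EFinM.
rewrite ge0_integralZl//; last 2 first.
- apply/measurable_EFinP; exact: measurable_sum.
- by move=> x _; rewrite lee_fin sumr_ge0.
rewrite EFinM lee_wpmul2l ?lee_fin//.
under eq_integral do rewrite -sumEFin.
rewrite ge0_integral_sum//; last 2 first.
- by move=> i; exact/measurable_EFinP.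
- by move=> i x _; rewrite lee_fin.
apply: (@le_trans _ _ (\sum_(i < n) b%:E)%E); first exact: lee_sum.
by rewrite sumEFin sumr_const card_ord mulr_natl.
Qed.

(** Used to read the finiteness of the iterates of [V] off the ergodicity bound. *)
Lemma dist_EFin_le_bound (R : realType) (a : \bar R) (v c : R) :
  (`|a - v%:E| <= c%:E)%E -> (a <= (v + c)%:E)%E.
Proof.
case: a => [r| |] /=; rewrite ?leey ?leNye//.
by rewrite !lee_fin => h; have := le_trans (ler_norm _) h; lra.
Qed.

(** Each [M k] is the power [(2 + delta)^-1] of [U k], so [powR_le_affine] at [L] bounds its mean by
    [2 * L^al]. Its square is at most [1 + U k], of mean at most [2 * L] as [1 <= L]; Cauchy-Schwarz
    over the [m] terms gives [m^2]. *)
Lemma envelope_moments (R : realType) (d : measure_display)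
  (T : measurableType d) (mu : {measure set T -> \bar R}) (w : T -> R)
  (m : nat) (M : 'I_m -> T -> R) (delta L : R) :
  density mu w -> 1 <= L -> 0 < delta ->
  (forall k y, 0 <= M k y) -> (forall k, measurable_fun setT (M k)) ->
  (forall k, \int[mu]_y (M k y `^ (2 + delta) * w y)%:E <= L%:E)%E ->
  [/\ wint mu w (fun y => \sum_k M k y),
      wint mu w (fun y => (\sum_k M k y) ^+ 2),
      wexp mu w (fun y => \sum_k M k y) <= 2 * m%:R * L `^ (2 + delta)^-1 &
      wexp mu w (fun y => (\sum_k M k y) ^+ 2) <= 2 * m%:R ^+ 2 * L].
Proof.
move=> dw L1 delta0 M0 mM hM.
have L0 : 0 < L by exact: lt_le_trans L1.
set al := (2 + delta)^-1.
have e0 : 0 < 2 + delta by lra.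
have al0 : 0 < al by rewrite invr_gt0.
have al1 : al < 1 by rewrite invf_lt1//; lra.
pose U k y := M k y `^ (2 + delta).
have mU k : measurable_fun setT (U k).
  exact: (measurableT_comp (measurable_powR (2 + delta))).
have UE k : (\int[mu]_y (w y * U k y)%:E <= L%:E)%E.
  by under eq_integral do rewrite mulrC; exact: hM.
have iU k : wint mu w (U k).
  apply: wint_ge0 => //; first by move=> y; exact: powR_ge0.
  exact: le_lt_trans (UE k) (ltry _).
have eU k : wexp mu w (U k) <= L by rewrite -lee_fin -wexpE.
pose J k y := L `^ al + L `^ (al - 1) * U k y.
have iJ k : wint mu w (J k) by apply: wintD; [exact: wint_cst|exact: wintZ].
have MJ k y : M k y <= J k y.
  have -> : M k y = U k y `^ al.
    by rewrite /U -powRrM mulfV ?gt_eqF// powRr1.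
  by apply: powR_le_affine => //; exact: powR_ge0.
have iM k : wint mu w (M k).
  by apply: (wint_dom mu w (M k) (J k)) => // y; rewrite ger0_norm.
have eM k : wexp mu w (M k) <= 2 * L `^ al.
  apply: (@le_trans _ _ (wexp mu w (J k))); first exact: wexp_le.
  rewrite wexpD ?wexpZ ?wexp_cst//; [|exact: wint_cst|exact: wintZ].
  rewrite mulr_natl mulr2n lerD2l.
  apply: (@le_trans _ _ (L `^ (al - 1) * L)).
    by rewrite ler_wpM2l ?powR_ge0.
  by rewrite mulrC mulr_powRB1// ltW.
pose Q k y := 1 + U k y.
have iQ k : wint mu w (Q k) by apply: wintD => //; exact: wint_cst.
have M2Q k y : M k y ^+ 2 <= Q k y by apply: sqr_le_1_powR => //; exact: ltW.
have eQ k : wexp mu w (Q k) <= 2 * L.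
  rewrite wexpD ?wexp_cst//; last exact: wint_cst.
  by have := eU k; lra.
pose N y := \sum_k M k y.
have mN : measurable_fun setT N by exact: measurable_sum.
pose H y := m%:R * \sum_k Q k y.
have iH : wint mu w H by apply: wintZ; exact: wint_sum.
have NH y : N y ^+ 2 <= H y.
  by apply: le_trans (sqr_sum_le _ _ _) _; rewrite ler_wpM2l// ler_sum.
have iN2 : wint mu w (fun y => N y ^+ 2).
  apply: (wint_dom mu w _ H) => //; first exact: measurable_funX.
  by move=> y; rewrite ger0_norm ?sqr_ge0.
split=> //; first exact: wint_sum.
- rewrite wexp_sum//.
  apply: (@le_trans _ _ (\sum_(k < m) 2 * L `^ al)); first exact: ler_sum.
  by rewrite sumr_const card_ord -[leLHS]mulr_natl mulrA [_ * 2]mulrC.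
- apply: (@le_trans _ _ (wexp mu w H)); first exact: wexp_le.
  rewrite wexpZ; last exact: wint_sum.
  rewrite wexp_sum//.
  have -> : 2 * m%:R ^+ 2 * L = m%:R * (m%:R * (2 * L)) by ring.
  rewrite ler_wpM2l//.
  apply: (@le_trans _ _ (\sum_(k < m) 2 * L)); first exact: ler_sum.
  by rewrite sumr_const card_ord [leRHS]mulr_natl.
Qed.

(** The constants depend only on the chain under theta0 and its envelopes, not on [k'], [F] or [n],
    so the bounds can later be integrated over theta. *)
Lemma chain_KL_Var_bounds (R : realType) (d : measure_display)
  (T : measurableType d) (mu : {sigma_finite_measure set T -> \bar R})
  (k : T -> T -> R) (q0 V qinv : T -> R) (Rc tau : R) (m : nat)
  (M : 'I_m -> T -> T -> R) (delta : R) :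
  (forall x y, 0 < k x y) ->
  measurable_fun setT (fun xy : T * T => k xy.1 xy.2) ->
  (forall x, \int[mu]_y (k x y)%:E = 1)%E ->
  density mu q0 -> density mu qinv ->
  (forall x, 1 <= V x) -> measurable_fun setT V ->
  (\int[mu]_x (V x * qinv x)%:E < +oo)%E ->
  (\int[mu]_x (q0 x * V x)%:E < +oo)%E ->
  0 < tau < 1 ->
  (forall g : T -> R, measurable_fun setT g -> (forall y, `|g y| <= V y) ->
    forall x n,
      (`|nstep mu k n (fun y => (g y)%:E) x - \int[mu]_y (g y * qinv y)%:E|
       <= (Rc * V x * tau ^+ n)%:E)%E) ->
  0 < delta ->
  (forall i y x, 0 <= M i y x) ->
  (forall i, measurable_fun setT (fun yx : T * T => M i yx.1 yx.2)) ->
  (forall i x, \int[mu]_y (M i y x `^ (2 + delta) * k x y)%:E <= (V x)%:E)%E ->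
  exists K1 K2 : R, [/\ 0 <= K1, 0 <= K2 &
    forall (k' : T -> T -> R) (F : R), 0 <= F ->
      (forall x y, 0 < k' x y) ->
      measurable_fun setT (fun xy : T * T => k' xy.1 xy.2) ->
      (forall x y, `|ln (k x y) - ln (k' x y)| <= F * \sum_i M i y x) ->
      forall n, (0 < n)%N ->
        (KL_chain mu q0 k k' n <= (n%:R * K1 * F)%:E)%E /\
        (Var_chain mu q0 k k' n <= (n%:R * K2 * F ^+ 2)%:E)%E].
Proof.
move=> k0 mk k1 dq0 dq V1 mV qVoo q0Voo tau01 hgeo delta0 M0 mM hM.
have dk x : density mu (k x).
  split=> //; first exact: (measurableT_comp mk (pair1_measurable x)).
  by move=> y; exact: ltW.
have V0 x : 0 <= V x by exact: le_trans (V1 x).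
have qV : wint mu qinv V.
  by apply: wint_ge0 => //; under eq_integral do rewrite mulrC.
have q0V : wint mu q0 V by exact: wint_ge0.
(* Ergodicity applied to [V] itself bounds each iterate by [v + |Rc| * V], hence by [B * V] as
   [V >= 1]. The absolute value makes the constant nonnegative. *)
pose v := wexp mu qinv V; pose B := v + `|Rc|.
have v0 : 0 <= v by exact: wexp_ge0.
have B0 : 0 <= B by rewrite addr_ge0.
have tauV n x : Rc * V x * tau ^+ n <= `|Rc| * V x * tau ^+ n.
  by have /andP[/ltW t0 _] := tau01; rewrite ler_wpM2r ?exprn_ge0// ler_wpM2r// ler_norm.
have nV n x : (nstep mu k n (fun y => (V y)%:E) x <= (B * V x)%:E)%E.
  have := hgeo V mV (fun y => _) x n.
  have -> : (\int[mu]_y (V y * qinv y)%:E = v%:E)%E.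
    by rewrite -wexpE//; under eq_integral do rewrite mulrC.
  have VV y : `|V y| <= V y by rewrite ger0_norm.
  move=> /(_ VV)/dist_EFin_le_bound/le_trans; apply; rewrite lee_fin.
  rewrite /B mulrDl lerD//; first by rewrite ler_peMr.
  apply: le_trans (tauV n x) _; rewrite ler_piMr ?mulr_ge0//.
  by have /andP[/ltW t0 /ltW t1] := tau01; rewrite exprn_ile1.
have kV x : wint mu (k x) V.
  by apply: wint_ge0 => //; exact: le_lt_trans (nV 1%N x) (ltry _).
have PV x : Pop mu k V x <= B * V x.
  by rewrite -lee_fin /Pop -wexpE//; exact: (nV 1%N x).
have nE c f n x : Vdom V c f ->
    nstep mu k n (fun y => (f y)%:E) x = (iter n (Pop mu k) f x)%:E.
  by move=> hf; exact: (nstep_iter mu k dk mk V B V1 kV PV c f n x hf).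
have VB n x : iter n (Pop mu k) V x <= B * V x.
  by rewrite -lee_fin -(nE 1)//; exact: Vdom_V.
have geo (f : T -> R) : measurable_fun setT f -> (forall y, `|f y| <= V y) ->
    forall x n, `|iter n (Pop mu k) f x - wexp mu qinv f| <= `|Rc| * V x * tau ^+ n.
  move=> mf fV x n; apply: le_trans (tauV n x).
  have hf : Vdom V 1 f by split=> // y; rewrite mul1r.
  have := hgeo f mf fV x n; rewrite (nE 1)//.
  under eq_integral do rewrite mulrC.
  by rewrite wexpE//; exact: (Vdom_wint mu V qinv 1).
pose N x y := \sum_i M i y x.
pose cN : R := 2 * m%:R + 2 * m%:R ^+ 2.
pose al := (2 + delta)^-1.
have al01 : 0 < al < 2^-1.
  apply/andP; split; first by rewrite invr_gt0; lra.
  by rewrite ltf_pV2 ?posrE; lra.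
have m2 : 0 <= 2 * m%:R ^+ 2 :> R by rewrite mulr_ge0.
have m1 : 0 <= 2 * m%:R :> R by rewrite mulr_ge0.
have cN0 : 0 <= cN by rewrite addr_ge0.
have hN x := envelope_moments R d T mu (k x) m (fun i y => M i y x) delta (V x)
  (dk x) (V1 x) delta0 (fun i y => M0 i y x)
  (fun i => measurableT_comp (mM i) (pair2_measurable x)) (fun i => hM i x).
have kN x : wint mu (k x) (N x) by case: (hN x).
have kN2 x : wint mu (k x) (fun y => N x y ^+ 2) by case: (hN x).
have N1 x : wexp mu (k x) (N x) <= cN * V x `^ al.
  case: (hN x) => _ _ /le_trans h _; apply: h.
  by rewrite ler_wpM2r ?powR_ge0// lerDl.
have N2 x : wexp mu (k x) (fun y => N x y ^+ 2) <= cN * V x.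
  case: (hN x) => _ _ _ /le_trans h; apply: h.
  by rewrite ler_wpM2r// lerDr.
exists (cN * B * wexp mu q0 V), (varcst mu V B qinv `|Rc| tau al cN q0).
have D0 : 0 <= wexp mu q0 V by exact: wexp_ge0.
split.
- by rewrite !mulr_ge0.
- by apply: varcst_ge0.
move=> k' F F0 k'0 mk' hk' n n0.
pose g x y := ln (k x y) - ln (k' x y).
have mg : measurable_fun setT (fun xy : T * T => g xy.1 xy.2).
  by apply: measurable_funB; exact: measurableT_comp.
split.
- exact: (KL_chain_le mu k dk mk V B V1 mV kV PV al al01 VB g N F cN mg F0 cN0).
- exact: (Var_chain_le mu k dk mk V B V1 mV B0 kV PV qinv _ _ _ dq qV _ tau01
    al01 VB geo g N F cN mg F0 cN0).
Qed.

(** * Integration over [rho n] and the choice of the rate *)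

Local Open Scope ereal_scope.

Theorem mainTheorem10
  (R : realType) (dT dP : measure_display)
  (T : measurableType dT) (Theta : measurableType dP)
  (mu : {sigma_finite_measure set T -> \bar R})
  (p : Theta -> T -> T -> R) (q0 : T -> R) (theta0 : Theta)
  (pi : probability Theta R) (F : set (probability Theta R))
  (rho : nat -> probability Theta R)
  (* the Markov model: p theta x y = p_theta(y|x) is a transition density *)
  (hp_pos : forall th x y, (0 < p th x y)%R)
  (hp_meas : forall th, measurable_fun setT (fun xy : T * T => p th xy.1 xy.2))
  (hp_norm : forall th x, \int[mu]_y (p th x y)%:E = 1)
  (* q0 is the (common, known) initial density *)
  (hq0_ge0 : forall x, (0 <= q0 x)%R)
  (hq0_meas : measurable_fun setT q0)
  (hq0_norm : \int[mu]_x (q0 x)%:E = 1)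
  (* V-geometric ergodicity under theta0 *)
  (V : T -> R) (qinv : T -> R) (Rc tau : R)
  (hV1 : forall x, (1 <= V x)%R)
  (hV_meas : measurable_fun setT V)
  (hqinv_ge0 : forall x, (0 <= qinv x)%R)
  (hqinv_meas : measurable_fun setT qinv)
  (hqinv_norm : \int[mu]_x (qinv x)%:E = 1)
  (hqinv_inv : forall A, measurable A ->
      \int[mu]_x ((qinv x)%:E * \int[mu]_(y in A) (p theta0 x y)%:E)
      = \int[mu]_(y in A) (qinv y)%:E)
  (hVqinv : \int[mu]_x (V x * qinv x)%:E < +oo)
  (htau : (0 < tau < 1)%R)
  (hgeo : forall (g : T -> R), measurable_fun setT g ->
      (forall y, (`|g y| <= V y)%R) ->
      forall x n,
        `| nstep mu (p theta0) n (fun y => (g y)%:E) x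
           - \int[mu]_y (g y * qinv y)%:E |
        <= (Rc * V x * tau ^+ n)%:E)
  (* Lipschitz-type bound on the log transition densities *)
  (m : nat) (M : 'I_m -> T -> T -> R) (f : 'I_m -> Theta -> Theta -> R)
  (hM_ge0 : forall k y x, (0 <= M k y x)%R)
  (hM_meas : forall k, measurable_fun setT (fun yx : T * T => M k yx.1 yx.2))
  (hLip : forall th1 th2 x y,
      (`| ln (p th1 x y) - ln (p th2 x y) |
        <= \sum_(k < m) M k y x * `| f k th2 th1 |)%R)
  (delta : R) (hdelta : (0 < delta)%R)
  (hMmom : forall k x,
      \int[mu]_y ((M k y x `^ (2 + delta)) * p theta0 x y)%:E < (V x)%:E)
  (* the approximating distributions rho_n *)
  (C : R) (hC : (0 < C)%R)
  (hrhoF : forall n, F (rho n))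
  (hf_meas : forall k, measurable_fun setT (fun th => f k th theta0))
  (hf_mom : forall k (n : nat), (0 < n)%N ->
      \int[rho n]_th (`| f k th theta0 | `^ (2 + delta))%:E
        <= (C / n%:R)%:E)
  (hf_abs : forall k (n : nat), (0 < n)%N ->
      \int[rho n]_th (`| f k th theta0 |)%:E
        <= (C / Num.sqrt n%:R)%:E)
  (hKL : forall n : nat, (0 < n)%N ->
      KLdiv (rho n) pi <= (C * Num.sqrt n%:R)%:E)
  (hq0V : \int[mu]_x (q0 x * V x)%:E < +oo) :
  exists eps : nat -> R,
    (exists K : R, forall n : nat, (0 < n)%N ->
        (eps n <= K * Num.max (Num.sqrt n%:R)^-1
                               (n%:R `^ (delta / 2) / n%:R))%R)
    /\ forall n : nat, (0 < n)%N ->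
      [/\ (* (C1) *)
          \int[rho n]_th KL_chain mu q0 (p theta0) (p th) n
            <= (n%:R * eps n)%:E,
          (* (C2) *)
          \int[rho n]_th Var_chain mu q0 (p theta0) (p th) n
            <= (n%:R * eps n)%:E
        & (* (C3) *)
          KLdiv (rho n) pi <= (n%:R * eps n)%:E].
Proof.
have hM2 k x :
    (\int[mu]_y (M k y x `^ (2 + delta) * p theta0 x y)%:E <= (V x)%:E)%E.
  exact: ltW.
have [K1 [K2 [K10 K20 hK]]] := chain_KL_Var_bounds R dT T mu (p theta0) q0 V qinv
  Rc tau m M delta (hp_pos theta0) (hp_meas theta0) (hp_norm theta0)
  (And3 hq0_meas hq0_ge0 hq0_norm) (And3 hqinv_meas hqinv_ge0 hqinv_norm)
  hV1 hV_meas hVqinv hq0V htau hgeo hdelta hM_ge0 hM_meas hM2.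
pose absf k th : R := `|f k th theta0|%R.
pose F1 th : R := (\sum_k absf k th)%R.
have mabs k : measurable_fun setT (absf k) by exact: measurableT_comp.
have F10 th : (0 <= F1 th)%R by apply: sumr_ge0 => k _; exact: normr_ge0.
have hb th n (n0 : (0 < n)%N) :
    KL_chain mu q0 (p theta0) (p th) n <= (n%:R * K1 * F1 th)%:E /\
    Var_chain mu q0 (p theta0) (p th) n <= (n%:R * K2 * F1 th ^+ 2)%:E.
  (* Each [|f k th theta0|] is enlarged to the full sum [F1 th], which then factors out of the
     envelope. *)
  apply: hK => // x y; apply: (le_trans (hLip theta0 th x y)).
  rewrite mulr_sumr; apply: ler_sum => k _; rewrite mulrC ler_wpM2r//.
  by rewrite /F1 (bigD1 k)//= lerDl; apply: sumr_ge0 => j _; exact: normr_ge0.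
pose mr : R := m%:R.
have mr0 : (0 <= mr)%R by exact: ler0n.
(* One nonnegative summand for each of (C3), (C1) and (C2), in this order; [2 * C] counts the two
   moments of [|f k|]. *)
pose K : R := (C + K1 * (mr * C) + K2 * mr * (mr * (2 * C)))%R.
have C0 : (0 <= C)%R by exact: ltW.
have t1 : (0 <= K1 * (mr * C))%R by rewrite !mulr_ge0.
have t2 : (0 <= K2 * mr * (mr * (2 * C)))%R by rewrite !mulr_ge0.
exists (fun n => K / Num.sqrt n%:R)%R; split.
  exists K => n n0; apply: ler_wpM2l; first by rewrite /K !addr_ge0.
  by rewrite le_max lexx.
move=> n n0.
have nr0 : (0 < n%:R :> R)%R by rewrite ltr0n.
have s0 : (0 < Num.sqrt (n%:R : R))%R by rewrite sqrtr_gt0.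
have s1 : (1 <= Num.sqrt (n%:R : R))%R.
  by rewrite -[leLHS]sqrtr1 ler_sqrt ?ler1n.
have ss : (Num.sqrt (n%:R : R) * Num.sqrt n%:R = n%:R)%R.
  by rewrite -expr2 sqr_sqrtr// ltW.
have nK c : (0 <= c)%R -> (c <= K)%R ->
    (n%:R * (c / Num.sqrt n%:R) <= n%:R * (K / Num.sqrt n%:R))%R.
  by move=> c0 cK; rewrite ler_pM2l// ler_pM2r// invr_gt0.
split.
- apply: (@le_trans _ _ (\int[rho n]_th (n%:R * K1 * F1 th)%:E)).
    apply: integral_le_ge0 => th; first by case: (hb th n n0).
    by rewrite lee_fin !mulr_ge0// ltW.
  apply: le_trans (integral_scaled_sum_le R dP Theta (rho n) m absf (n%:R * K1)
    (C / Num.sqrt n%:R) _ mabs _ (fun k => hf_abs k n n0)) _.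
  + by rewrite mulr_ge0// ltW.
  + by move=> k x; exact: normr_ge0.
  rewrite lee_fin.
  apply: le_trans (nK (K1 * (mr * C))%R t1 _); last by rewrite /K; lra.
  by rewrite le_eqVlt; apply/orP; left; apply/eqP; rewrite /mr; ring.
- pose h k th : R := (absf k th + absf k th `^ (2 + delta))%R.
  have mpow k : measurable_fun setT (fun th => absf k th `^ (2 + delta))%R.
    exact: (measurableT_comp (measurable_powR (2 + delta))).
  have mh k : measurable_fun setT (h k) by exact: measurable_funD.
  have h0 k th : (0 <= h k th)%R.
    by rewrite /h addr_ge0 ?powR_ge0//; exact: normr_ge0.
  have ih k : \int[rho n]_th (h k th)%:E <= (2 * C / Num.sqrt n%:R)%:E.
    under eq_integral do rewrite EFinD.
    rewrite ge0_integralD//; last 4 first.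
    + by move=> th _; rewrite lee_fin; exact: normr_ge0.
    + exact/measurable_EFinP.
    + by move=> th _; rewrite lee_fin; exact: powR_ge0.
    + exact/measurable_EFinP.
    apply: le_trans (leeD (hf_abs k n n0) (hf_mom k n n0)) _.
    rewrite -EFinD lee_fin.
    have : (C / n%:R <= C / Num.sqrt n%:R)%R.
      rewrite ler_pM2l// lef_pV2 ?posrE// -[leRHS]ss ler_peMr// ltW.
    lra.
  have F2 th : (F1 th ^+ 2 <= mr * \sum_k h k th)%R.
    apply: le_trans (sqr_sum_le _ _ _) _; rewrite ler_wpM2l//.
    apply: ler_sum => k _; apply: sqr_le_addr_powR; first exact: ltW.
    exact: normr_ge0.
  apply: (@le_trans _ _ (\int[rho n]_th (n%:R * K2 * mr * \sum_k h k th)%:E)).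
    apply: integral_le_ge0 => th.
      have [_ /le_trans] := hb th n n0; apply; rewrite lee_fin -[leRHS]mulrA.
      by rewrite ler_wpM2l// mulr_ge0// ltW.
    by rewrite lee_fin mulr_ge0 ?sumr_ge0// !mulr_ge0// ltW.
  apply: le_trans (integral_scaled_sum_le R dP Theta (rho n) m h (n%:R * K2 * mr)
    (2 * C / Num.sqrt n%:R) _ mh h0 ih) _.
    by rewrite !mulr_ge0// ltW.
  rewrite lee_fin.
  apply: le_trans (nK (K2 * mr * (mr * (2 * C)))%R t2 _); last by rewrite /K; lra.
  by rewrite le_eqVlt; apply/orP; left; apply/eqP; rewrite /mr; ring.
- apply: le_trans (hKL n n0) _; rewrite lee_fin.
  apply: le_trans (nK C C0 _); last by rewrite /K; lra.
  rewrite -[X in (X * (C / _))%R]ss.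
  by rewrite [leRHS](_ : _ = C * Num.sqrt n%:R)%R//; field; rewrite gt_eqF.
Qed.
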